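(* Let $r\ge 2$. The group $B(\infty,\infty,r)$ has the following presentation. Generators: $T\cup S$ where $T=\{t_i\mid i\in\mathbb{Z}\}$ and $S=\{s_3,\ldots,s_r\}$. Relations: the usual braid relations on $S$, along with - $(Q_1)$ $t_it_{i-1}=t_jt_{j-1}$ for $i,j\in\mathbb{Z}$; - $(Q_2)$ $s_3t_is_3=t_is_3t_i$ for $i\in\mathbb{Z}$; - $(Q_3)$ $s_jt_i=t_is_j$ for $i\in\mathbb{Z}$ and $4\le j\le r$. (Here the generators $t_0,t_1,s_3,\ldots,s_r$ are those of the defining presentation of $B(\infty,\infty,r)$.) Furthermore, adding the relations $a^2=1$ for all generators $a\in T\cup S$ gives a presentation of the group $G(\infty,\infty,r)$, in which the generators are all reflections.
   Context: The usual braid relations on $S=\{s_3,\ldots,s_r\}$ are $s_is_j=s_js_i$ for $|i-j|\ge 2$ and $s_is_{i+1}s_i=s_{i+1}s_is_{i+1}$ for $3\le i\le r-1$. If $r=2$ then $S=\emptyset$ and all relations involving some $s_j$ are absent. Definition of $B(\infty,\infty,r)$ ($r\ge2$): the group with generators $\{t_0,t_1\}\cup S$, $S=\{s_3,\ldots,s_r\}$, and relations: the usual braid relations on $S$; $s_3t_is_3=t_is_3t_i$ for $i=0,1$; $s_jt_i=t_is_j$ for $i=0,1$ and $4\le j\le r$; and $s_3(t_1t_0)s_3(t_1t_0)=(t_1t_0)s_3(t_1t_0)s_3$. $G(\infty,\infty,r)$ is the group obtained from this presentation by adding the relations $a^2=1$ for all generators $a\in\{t_0,t_1\}\cup S$.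 By Shi, it is realized faithfully as the group of $r\times r$ matrices generated by $\overline{t_i}=\begin{pmatrix} 0 & x^{-i} \\ x^{i} & 0 \end{pmatrix}\oplus I_{r-2}$ ($i=0,1$) and $\overline{s_j}=$ the permutation matrix of the transposition $(j-1\ \ j)$ ($3\le j\le r$), where $x$ is a fixed transcendental number; a reflection in $G(\infty,\infty,r)$ is a nontrivial element whose matrix fixes a complex hyperplane of $\mathbb{C}^r$ pointwise. *)

(* Defs.v *)
(* The complex numbers are R[i] for R : realType. *)
From HB Require Import structures.
From mathcomp Require Import all_boot all_order all_algebra all_fingroup.
From mathcomp Require Import generic_quotient boolp reals complex.
From mathcomp Require Import zify.

Set Implicit Arguments.
Unset Strict Implicit.
Unset Printing Implicit Defensive.

Import GRing.Theory.
Local Open Scope quotient_scope.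

(* A letter is a pair (a, e): the generator a if e = false, its formal inverse
   if e = true.  A presentation is a relation R on positive words; R u v stands
   for the defining relation u = v. *)
Definition word (X : Type) := seq (X * bool).
HB.instance Definition _ (X : Type) := gen_eqMixin (word X).
HB.instance Definition _ (X : Type) := gen_choiceMixin (word X).

Definition pos (X : Type) (u : seq X) : word X := [seq (a, false) | a <- u].

Definition flip (X : Type) (l : X * bool) : X * bool := (l.1, ~~ l.2).

Inductive word_eq (X : Type) (R : seq X -> seq X -> Prop) :
    word X -> word X -> Prop :=
| WRefl w : word_eq R w w
| WSym v w : word_eq R v w -> word_eq R w v
| WTrans u v w : word_eq R u v -> word_eq R v w -> word_eq R u w
| WCat u u' v v' :
    word_eq R u u' -> word_eq R v v' -> word_eq R (u ++ v) (u' ++ v')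
| WCancel l : word_eq R [:: l; flip l] [::]
| WRel u v : R u v -> word_eq R (pos u) (pos v).

Section PresentedGroup.
Variables (X : Type) (R : seq X -> seq X -> Prop).

Definition word_eqb : rel (word X) := fun v w => `[< word_eq R v w >].

Lemma word_eqb_equiv : equiv_class_of word_eqb.
Proof.
split.
- by move=> w; apply/asboolP; apply: WRefl.
- by move=> v w; apply/asboolP/asboolP; apply: WSym.
- by move=> v u w /asboolP uv /asboolP vw; apply/asboolP; apply: WTrans vw.
Qed.

Canonical word_equiv := EquivRelPack word_eqb_equiv.

Definition presented : Type := {eq_quot word_equiv}.
HB.instance Definition _ := Choice.on presented.

Definition cls (w : word X) : presented := \pi_{eq_quot word_equiv} w.
Definition rep (g : presented) : word X := repr (g : {eq_quot word_equiv}).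

Lemma clsP v w : cls v = cls w <-> word_eq R v w.
Proof. by split=> [/eqmodP/asboolP // | vw]; apply/eqmodP/asboolP. Qed.

Lemma repK : cancel rep cls.
Proof. exact: (@reprK _ {eq_quot word_equiv}). Qed.

Lemma rep_cls w : word_eq R (rep (cls w)) w.
Proof. by apply/clsP; rewrite repK. Qed.

Definition winv (w : word X) : word X := rev (map (@flip X) w).

Lemma flipK : involutive (@flip X).
Proof. by case=> a e; rewrite /flip /= negbK. Qed.

Lemma winvK : involutive winv.
Proof. by move=> w; rewrite /winv map_rev revK mapK //; apply: flipK. Qed.

Lemma winv_cat v w : winv (v ++ w) = winv w ++ winv v.
Proof. by rewrite /winv map_cat rev_cat. Qed.

Lemma winvr w : word_eq R (w ++ winv w) [::].
Proof.
elim: w => [|l w IHw]; first exact: WRefl.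
rewrite /winv map_cons rev_cons -cat1s -cats1 -catA [w ++ _]catA.
apply: WTrans (WCancel R l); rewrite -[[:: l; _]]cat1s.
apply: WCat; first exact: WRefl.
by rewrite -[[:: flip l] in X in word_eq _ _ X]cat0s; apply: WCat IHw (WRefl _ _).
Qed.

Lemma winvl w : word_eq R (winv w ++ w) [::].
Proof. by rewrite -{2}[w]winvK; apply: winvr. Qed.

Lemma winv_eq v w : word_eq R v w -> word_eq R (winv v) (winv w).
Proof.
move=> vw; have h1 : word_eq R (winv v) (winv v ++ (w ++ winv w)).
  apply: WSym; rewrite -[X in word_eq _ _ X]cats0.
  exact: WCat (WRefl _ _) (winvr w).
apply: WTrans h1 _; rewrite catA -[X in word_eq _ _ X]cat0s.
apply: WCat; last exact: WRefl.
by apply: WTrans (winvl v); apply: WCat (WRefl _ _) (WSym vw).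
Qed.

Definition pmul (g h : presented) : presented := cls (rep g ++ rep h).
Definition pone : presented := cls [::].
Definition pinv (g : presented) : presented := cls (winv (rep g)).

Lemma pmul_cls v w : pmul (cls v) (cls w) = cls (v ++ w).
Proof. by apply/clsP; apply: WCat; apply: rep_cls. Qed.

Lemma pinv_cls w : pinv (cls w) = cls (winv w).
Proof. by apply/clsP; apply: winv_eq; apply: rep_cls. Qed.

Lemma pmulA : associative pmul.
Proof.
by move=> a b c; rewrite -(repK a) -(repK b) -(repK c) !pmul_cls catA.
Qed.

Lemma pmul1g : left_id pone pmul.
Proof. by move=> a; rewrite -(repK a) pmul_cls. Qed.

Lemma pmulg1 : right_id pone pmul.
Proof. by move=> a; rewrite -(repK a) pmul_cls cats0. Qed.

Lemma pmulVg : left_inverse pone pinv pmul.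
Proof.
by move=> a; rewrite -(repK a) pinv_cls pmul_cls; apply/clsP; apply: winvl.
Qed.

Lemma pmulgV : right_inverse pone pinv pmul.
Proof.
by move=> a; rewrite -(repK a) pinv_cls pmul_cls; apply/clsP; apply: winvr.
Qed.

HB.instance Definition _ :=
  isGroup.Build presented pmulA pmul1g pmulg1 pmulVg pmulgV.

Definition pgen (a : X) : presented := cls [:: (a, false)].

End PresentedGroup.

Arguments presented {X} R.
Arguments pgen {X} R a.

Inductive add_squares (X : Type) (R : seq X -> seq X -> Prop) :
    seq X -> seq X -> Prop :=
| Old_rel u v : R u v -> add_squares R u v
| Square a : add_squares R [:: a; a] [::].

(* Generators t_i (i : I) and s_3, ..., s_r; the index j of s_j is the natural
   number itself, so there is no s_j when r = 2. *)
Definition Sidx (r : nat) := {j : nat | (3 <= j <= r)%N}.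

Inductive gen (I : Type) (r : nat) : Type :=
| Tg (i : I)
| Sg (j : Sidx r).
Arguments Tg {I r} i.
Arguments Sg {I r} j.

Inductive braid_rel (I : Type) (r : nat) :
    seq (gen I r) -> seq (gen I r) -> Prop :=
| Braid_comm (i j : Sidx r) :
    ((val i).+2 <= val j)%N || ((val j).+2 <= val i)%N ->
    braid_rel [:: Sg i; Sg j] [:: Sg j; Sg i]
| Braid_braid (i j : Sidx r) :
    val j = (val i).+1 ->
    braid_rel [:: Sg i; Sg j; Sg i] [:: Sg j; Sg i; Sg j].

(* Defining presentation: t_0 = Tg false and t_1 = Tg true. *)
Inductive B_rel (r : nat) : seq (gen bool r) -> seq (gen bool r) -> Prop :=
| B_braid u v : braid_rel u v -> B_rel u v
| B_st (j : Sidx r) (i : bool) :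
    val j = 3%N -> B_rel [:: Sg j; Tg i; Sg j] [:: Tg i; Sg j; Tg i]
| B_comm (j : Sidx r) (i : bool) :
    (4 <= val j)%N -> B_rel [:: Sg j; Tg i] [:: Tg i; Sg j]
| B_stt (j : Sidx r) :
    val j = 3%N ->
    B_rel [:: Sg j; Tg true; Tg false; Sg j; Tg true; Tg false]
          [:: Tg true; Tg false; Sg j; Tg true; Tg false; Sg j].

Definition Binf (r : nat) := presented (@B_rel r).
Definition Ginf (r : nat) := presented (add_squares (@B_rel r)).
HB.instance Definition _ r := Group.on (Binf r).
HB.instance Definition _ r := Group.on (Ginf r).

Inductive Q_rel (r : nat) : seq (gen int r) -> seq (gen int r) -> Prop :=
| Q_braid u v : braid_rel u v -> Q_rel u v
| Q_1 (i j : int) :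
    Q_rel [:: Tg i; Tg (i - 1)%R] [:: Tg j; Tg (j - 1)%R]
| Q_2 (j : Sidx r) (i : int) :
    val j = 3%N -> Q_rel [:: Sg j; Tg i; Sg j] [:: Tg i; Sg j; Tg i]
| Q_3 (j : Sidx r) (i : int) :
    (4 <= val j)%N -> Q_rel [:: Sg j; Tg i] [:: Tg i; Sg j].

(* f sends t_0, t_1 and the s_j to the generators of the same name. *)
Definition respects_gens (r : nat)
    (R : seq (gen int r) -> seq (gen int r) -> Prop)
    (R' : seq (gen bool r) -> seq (gen bool r) -> Prop)
    (f : presented R -> presented R') : Prop :=
  [/\ f (pgen R (Tg 0%R)) = pgen R' (Tg false),
      f (pgen R (Tg 1%R)) = pgen R' (Tg true)
    & forall j : Sidx r, f (pgen R (Sg j)) = pgen R' (Sg j)].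

Local Open Scope ring_scope.

Definition transcendental (R : realType) (x : R[i]) : Prop :=
  ~ algebraicOver (ratr : rat -> R[i]) x.

Section Realization.
Variables (R : realType) (x : R[i]) (r : nat).

Definition t_mx (i : bool) : 'M[R[i]]_r := \matrix_(k < r, l < r)
  if (k == 0 :> nat) && (l == 1 :> nat) then x ^- i
  else if (k == 1 :> nat) && (l == 0 :> nat) then x ^+ i
  else ((k == l) && (2 <= k)%N)%:R.

Lemma Sidx_lt1 (j : Sidx r) : ((val j).-2 < r)%N.
Proof. by case: j => j /= ?; lia. Qed.
Lemma Sidx_lt2 (j : Sidx r) : ((val j).-1 < r)%N.
Proof. by case: j => j /= ?; lia. Qed.

(* Matrix rows are numbered from 0, hence the shift in (j-1 j). *)
Definition s_mx (j : Sidx r) : 'M[R[i]]_r :=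
  tperm_mx (Ordinal (Sidx_lt1 j)) (Ordinal (Sidx_lt2 j)).

Definition gen_mx (a : gen bool r) : 'M[R[i]]_r :=
  match a with Tg i => t_mx i | Sg j => s_mx j end.

Definition letter_mx (l : gen bool r * bool) : 'M[R[i]]_r :=
  if l.2 then invmx (gen_mx l.1) else gen_mx l.1.

Definition word_mx (w : word (gen bool r)) : 'M[R[i]]_r :=
  foldr (fun l M => letter_mx l *m M) 1%:M w.

(* Independent of the representative word, and a morphism, as soon as x != 0
   and r >= 2: see G_mx_cls, G_mxM and G_mx_gen below. *)
Definition G_mx (g : Ginf r) : 'M[R[i]]_r := word_mx (rep g).

Definition fixes_hyperplane (M : 'M[R[i]]_r) : Prop :=
  exists H : {vspace 'cV[R[i]]_r},
    \dim H = r.-1 /\ forall v, v \in H -> M *m v = v.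

Definition is_reflection (g : Ginf r) : Prop :=
  g <> 1%g /\ fixes_hyperplane (G_mx g).

Lemma transcendental_neq0 : transcendental x -> x != 0.
Proof.
move=> hx; apply/eqP => x0; apply: hx; rewrite x0; exact: algebraic0.
Qed.

(* Row k of mon f c has its only nonzero entry c k in column f k. *)
Definition mon (f : nat -> nat) (c : nat -> R[i]) : 'M[R[i]]_r :=
  \matrix_(k < r, l < r) (c k *+ (f k == l)).

Lemma monM f c g d : (forall k, k < r -> f k < r)%N ->
  mon f c *m mon g d = mon (g \o f) (fun k => c k * d (f k)).
Proof.
move=> hf; apply/matrixP => k l; rewrite !mxE.
rewrite (bigD1 (Ordinal (hf k (ltn_ord k)))) //= !mxE /= eqxx mulr1n.
rewrite big1 ?addr0 ?mulrnAr // => m; rewrite -val_eqE /= !mxE => /negPf.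
by rewrite eq_sym => ->; rewrite mul0r.
Qed.

Lemma eq_mon f c g d : (forall k, k < r -> f k = g k)%N ->
  (forall k, (k < r)%N -> c k = d k) -> mon f c = mon g d.
Proof. by move=> fg cd; apply/matrixP => k l; rewrite !mxE fg ?cd. Qed.

Lemma mon1 : mon id (fun=> 1) = 1%:M.
Proof. by apply/matrixP => k l; rewrite !mxE. Qed.

Definition swp (a k : nat) : nat :=
  if k == a then a.+1 else if k == a.+1 then a else k.

Definition gpos (a : gen bool r) : nat :=
  match a with Tg _ => 0%N | Sg j => (val j).-2 end.

Definition gcoef (a : gen bool r) : nat -> R[i] :=
  match a with
  | Tg b => fun k => if k == 0%N then x ^- b else if k == 1%N then x ^+ b else 1
  | Sg _ => fun=> 1
  end.


Lemma gen_mxE a : gen_mx a = mon (swp (gpos a)) (gcoef a).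
Proof.
case: a => [b | j] /=; apply/matrixP => k l; rewrite !mxE /swp.
  rewrite -val_eqE /=; case: k l => [[|[|k]] hk] [[|[|l]] hl] //=.
  by rewrite andbT.
have hj : (3 <= val j <= r)%N := valP j.
have hE : (val j).-1 = (val j).-2.+1 by lia.
rewrite permE /= -!val_eqE /= -hE.
by case: ifP => _; [|case: ifP => _].
Qed.

Lemma gpos_lt a : (2 <= r -> (gpos a).+1 < r)%N.
Proof. by case: a => [b | [j hj]] /=; lia. Qed.

Lemma swp_lt a k : (a.+1 < r -> k < r -> swp a k < r)%N.
Proof. by rewrite /swp => *; do 2!case: ifP => //; lia. Qed.

Fixpoint wperm (u : seq (gen bool r)) (k : nat) : nat :=
  if u is a :: v then wperm v (swp (gpos a) k) else k.

Fixpoint wcoef (u : seq (gen bool r)) (k : nat) : R[i] :=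
  if u is a :: v then gcoef a k * wcoef v (swp (gpos a) k) else 1.

Hypotheses (r2 : (2 <= r)%N) (x0 : x != 0).

Lemma word_mx_pos u : word_mx (pos u) = mon (wperm u) (wcoef u).
Proof.
elim: u => [|a u IHu] /=; first by rewrite -mon1.
rewrite /letter_mx /= IHu gen_mxE monM // => k; apply: swp_lt.
exact: gpos_lt.
Qed.

Lemma word_mx_cat v w : word_mx (v ++ w) = word_mx v *m word_mx w.
Proof. by elim: v => [|l v IHv] /=; rewrite ?mul1mx // IHv mulmxA. Qed.

Lemma wcoefS (u : seq (gen bool r)) k :
  (forall a, List.In a u -> exists j, a = Sg j) -> wcoef u k = 1.
Proof.
elim: u k => [|a u IHu] k //= hu.
have [j -> /=] := hu a (or_introl erefl).
by rewrite mul1r IHu // => b hb; apply: hu; right.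
Qed.

Lemma rel_mon (u v : seq (gen bool r)) : add_squares (@B_rel r) u v ->
  wperm u =1 wperm v /\ wcoef u =1 wcoef v.
Proof.
have xV (b : bool) : x ^- b * x ^+ b = 1 by rewrite mulVf ?expf_neq0.
have Vx (b : bool) : x ^+ b * x ^- b = 1 by rewrite mulfV ?expf_neq0.
case=> {u v} [u v [{}u {}v huv|j b j3|j b j4|j j3]|[b|j]].
- split=> k; first last.
    by case: huv => *; rewrite !wcoefS // => a /=; intuition; eexists; eauto.
  case: huv => [] [i hi] [j hj] /= hij; rewrite /swp.
    by move: hi hj; do !case: eqP; lia.
  by move: hi hj; do !case: eqP; lia.
- by split=> [] [|[|[|k]]] //=; rewrite j3 /swp /= ?mul1r ?mulr1 ?xV ?Vx.
- split=> k /=.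
    by case: j j4 => j hj /= j4; rewrite /swp; do !case: eqP; lia.
  rewrite !mulr1 !mul1r /swp.
  by case: j j4 => j hj /= j4; do !case: eqP => //; lia.
- by split=> [] [|[|[|k]]] //=;
    rewrite j3 /swp /= ?expr0 ?expr1 ?invr1 ?mulr1 ?mul1r.
- by split=> [] [|[|k]] //=; rewrite /swp /= ?mulr1 ?xV ?Vx.
- by split=> k /=; rewrite ?mulr1 // /swp; do !case: eqP; lia.
Qed.

Lemma rel_mx (u v : seq (gen bool r)) :
  add_squares (@B_rel r) u v -> word_mx (pos u) = word_mx (pos v).
Proof.
by move=> /rel_mon[e1 e2]; rewrite !word_mx_pos; apply: eq_mon => k _.
Qed.

Lemma gen_mx_unit a : gen_mx a \in unitmx.
Proof.
have /= := rel_mx (Square (@B_rel r) a).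
by rewrite /letter_mx /= mulmx1 => /mulmx1_unit[].
Qed.

Lemma word_eq_mx v w :
  word_eq (add_squares (@B_rel r)) v w -> word_mx v = word_mx w.
Proof.
elim=> {v w} // [u v w _ -> _ -> //|u u' v v' _ e1 _ e2|[a []]|u v /rel_mx //].
- by rewrite !word_mx_cat e1 e2.
- by rewrite /= /letter_mx /= mulmx1 mulVmx ?gen_mx_unit.
- by rewrite /= /letter_mx /= mulmx1 mulmxV ?gen_mx_unit.
Qed.

Lemma G_mx_cls w : G_mx (cls _ w) = word_mx w.
Proof. by apply: word_eq_mx; apply: rep_cls. Qed.

Lemma G_mx1 : G_mx 1%g = 1%:M.
Proof. exact: G_mx_cls [::]. Qed.

Lemma G_mxM g h : G_mx (g * h)%g = G_mx g *m G_mx h.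
Proof.
by rewrite -[LHS]/(G_mx (cls _ (rep g ++ rep h))) G_mx_cls word_mx_cat.
Qed.

Lemma G_mx_gen a : G_mx (pgen _ a) = gen_mx a.
Proof. by rewrite /pgen G_mx_cls /= mulmx1. Qed.

End Realization.

(* Main.v *)
(** Put [z = t_1 t_0].  Relation (Q1) says [t_(i+1) = z t_i^-1] for all [i], so the
    whole family is determined by [t_0] and [t_1], and [t_(i+2)] is the conjugate
    of [t_i] by [t_(i+1)].  Commutation with [s_j], [a^2 = 1] and being a reflection
    therefore propagate from [t_0], [t_1] to every [t_i].  For (Q2) the key fact is
    that, if [s] braids with [a] and [b] and [c a = a b], then [s] braids with [c]
    if and only if [s(ab)s(ab) = (ab)s(ab)s]. *)
Require Import Defs.
From HB Require Import structures.
From mathcomp Require Import all_boot all_order all_algebra all_fingroup.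
From mathcomp Require Import boolp reals complex.
From mathcomp Require Import zify.

Set Implicit Arguments.
Unset Strict Implicit.
Unset Printing Implicit Defensive.

Import GRing.Theory.

(** * Braiding and integer-indexed families with t_(i+1) t_i constant *)

Section GroupFamilies.
Local Open Scope group_scope.
Variable G : groupType.
Implicit Types (a b c s z g : G) (t : int -> G).

Definition braided s a := s * a * s = a * s * a.

(** The two sides of the long relation turn into [s * c * s] and [c * s * c], each followed by the
    common factor [a * s * b], which cancels. *)
Lemma braided_up s a b c : braided s a -> braided s b -> c * a = a * b ->
  braided s c <->
  s * (a * b) * s * (a * b) = (a * b) * s * (a * b) * s.
Proof.
move=> sa sb ca.
have -> : s * (a * b) * s * (a * b) = s * c * s * (a * s * b).
  have -> : s * c * s * (a * s * b) = s * c * (s * a * s) * b by rewrite !mulgA.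
  rewrite sa.
  have -> : s * c * (a * s * a) * b = s * (c * a) * s * (a * b) by rewrite !mulgA.
  by rewrite ca.
have -> : (a * b) * s * (a * b) * s = c * s * c * (a * s * b).
  have -> : c * s * c * (a * s * b) = c * s * (c * a) * s * b by rewrite !mulgA.
  have -> : c * s * (c * a) * s * b = c * (s * a) * (b * s * b).
    by rewrite ca !mulgA.
  rewrite -sb.
  have -> : c * (s * a) * (s * b * s) = c * (s * a * s) * b * s by rewrite !mulgA.
  by rewrite sa !mulgA ca.
by split=> [->|/mulIg].
Qed.

(** Mirror argument: multiplying the two sides of the braid relation for [c] on the left by
    [a * s * b] gives the two sides of the long relation. *)
Lemma braided_down s a b c : braided s a -> braided s b -> b * c = a * b ->
  s * (a * b) * s * (a * b) = (a * b) * s * (a * b) * s -> braided s c.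
Proof.
move=> sa sb bc rel; apply: (mulgI (a * s * b)).
have -> : a * s * b * (s * c * s) = a * (s * b * s) * c * s by rewrite !mulgA.
have -> : a * s * b * (c * s * c) = a * s * (b * c) * s * c by rewrite !mulgA.
rewrite bc sb.
have -> : a * s * (a * b) * s * c = (a * s * a) * b * s * c by rewrite !mulgA.
rewrite -sa.
have -> : s * a * s * b * s * c = s * a * (s * b * s) * c by rewrite !mulgA.
rewrite sb.
have -> : a * (b * s * b) * c * s = (a * b) * s * (b * c) * s by rewrite !mulgA.
have -> : s * a * (b * s * b) * c = s * (a * b) * s * (b * c) by rewrite !mulgA.
by rewrite bc.
Qed.

Lemma int_ind2 (P : int -> Prop) : P 0%R -> P 1%R ->
  (forall i, P i -> P (i + 1)%R -> P (i + 2)%R) ->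
  (forall i, P (i + 1)%R -> P (i + 2)%R -> P i) -> forall i, P i.
Proof.
move=> P0 P1 up down i.
(* Carrying two consecutive indices makes the two-term recurrence a one-step induction in either
   direction. *)
suff [] : P i /\ P (i + 1)%R by [].
elim: i => [|n [IH1 IH2]|n [IH1 IH2]]; first by [].
  have -> : Posz n.+1 = (Posz n + 1)%R by lia.
  by split=> //; rewrite -addrA; apply: up.
have e1 : (- Posz n = - Posz n.+1 + 1)%R by lia.
split; last by rewrite -e1.
apply: down; first by rewrite -e1.
by have -> : (- Posz n.+1 + 2 = - Posz n + 1)%R by lia.
Qed.

(** This is (Q1) with its index shifted by one and one side fixed at j = 1. *)
Definition const_product t := forall i : int,
  t (i + 1)%R * t i = t 1%R * t 0%R.

Section ConstProduct.
Variable t : int -> G.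
Hypothesis tP : const_product t.

Lemma const_productS i : t (i + 2)%R * t (i + 1)%R = t (i + 1)%R * t i.
Proof. by rewrite tP -[2%R]/(1 + 1)%R addrA tP. Qed.

(** Keeping [P] abstract lets one argument serve both for a^2 = 1 and for being a reflection. *)
Lemma const_product_conj (P : G -> Prop) :
  (forall g h, P g -> P (g ^ h)) -> P (t 0%R) -> P (t 1%R) -> forall i, P (t i).
Proof.
move=> PJ P0 P1; apply: int_ind2 => // i Pi Pi1.
  suff -> : t (i + 2)%R = t i ^ (t (i + 1)%R)^-1 by apply: PJ.
  by rewrite conjgE invgK mulgA -const_productS mulgK.
suff -> : t i = t (i + 2)%R ^ t (i + 1)%R by apply: PJ.
by rewrite conjgE const_productS mulKg.
Qed.

Lemma const_product_commute g :
  commute g (t 0%R) -> commute g (t 1%R) -> forall i, commute g (t i).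
Proof.
move=> c0 c1; apply: int_ind2 => // i ci ci1.
  have -> : t (i + 2)%R = t (i + 1)%R * t i * (t (i + 1)%R)^-1.
    by rewrite -const_productS mulgK.
  by apply: commuteM; [exact: commuteM | exact: commuteV].
have -> : t i = (t (i + 1)%R)^-1 * (t (i + 2)%R * t (i + 1)%R).
  by rewrite const_productS mulKg.
by apply: commuteM; [exact: commuteV | exact: commuteM].
Qed.

Lemma const_product_braided s : braided s (t 0%R) -> braided s (t 1%R) ->
  let z := t 1%R * t 0%R in s * z * s * z = z * s * z * s ->
  forall i, braided s (t i).
Proof.
(* The roles of a, b, c are played by t_(i+1), t_i, t_(i+2) going up and by t_(i+2), t_(i+1), t_i
   going down; in both cases a b = z. *)
move=> b0 b1 z rel; apply: int_ind2 => // i bi bi1.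
  by apply/(braided_up bi1 bi (const_productS i)); rewrite tP.
apply: (braided_down bi1 bi (esym (const_productS i))).
by rewrite const_productS tP.
Qed.

(** The long relation comes from the braid relations of s with t_0, t_1 and t_2, taking c = t_2. *)
Lemma braided_const_product s : (forall i, braided s (t i)) ->
  let z := t 1%R * t 0%R in s * z * s * z = z * s * z * s.
Proof.
move=> b z; apply/(braided_up (b 1%R) (b 0%R) (const_productS 0%R)).
exact: b.
Qed.

End ConstProduct.

Lemma const_product_uniq t t' : const_product t -> const_product t' ->
  t 0%R = t' 0%R -> t 1%R = t' 1%R -> t =1 t'.
Proof.
move=> tP tP' e0 e1; apply: int_ind2 => // i ei ei1.
  apply: (mulIg (t (i + 1)%R)).
  by rewrite const_productS // [in RHS]ei1 const_productS // ei ei1.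
by apply: (mulgI (t (i + 1)%R)); rewrite -const_productS // ei ei1 const_productS.
Qed.

(** Starting from t_0 = a, the equation t_(i+1) t_i = b a is solved for its left factor going up and
    its right factor going down. [Negz n] stands for -(n+1), hence [n.+1] iterations. *)
Definition tfam a b (i : int) : G :=
  match i with
  | Posz n => iter n (fun g => b * a * g^-1) a
  | Negz n => iter n.+1 (fun g => g^-1 * (b * a)) a
  end.

Lemma tfam1 a b : tfam a b 1%R = b.
Proof. by rewrite /= mulgK. Qed.

Lemma tfam_const_product a b : const_product (tfam a b).
Proof.
(* Index -1 is a separate case, because its successor 0 lies in the other branch of [tfam]. *)
move=> i; rewrite tfam1 -[tfam a b 0%R]/a; case: i => [n|[|n]].
- by rewrite -PoszD addn1 /= mulgVK.
- by rewrite /= mulVKg.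
- have -> : (Negz n.+1 + 1 = Negz n)%R by lia.
  by rewrite [tfam a b (Negz n.+1)]iterS mulVKg.
Qed.

End GroupFamilies.

(** * Homomorphisms and the universal property of a presented group *)

Section Multiplicative.
Local Open Scope group_scope.
Variables (H G : groupType) (F : {multiplicative H -> G}).

Lemma multiplicative1 : F 1 = 1.
Proof. by apply: (mulIg (F 1)); rewrite -gmulfM !mul1g. Qed.

Lemma multiplicativeV g : F g^-1 = (F g)^-1.
Proof. by apply: (mulIg (F g)); rewrite -gmulfM !mulVg multiplicative1. Qed.

End Multiplicative.

Lemma clsM (X : Type) (R : seq X -> seq X -> Prop) v w :
  cls R (v ++ w) = (cls R v * cls R w)%g.
Proof. by rewrite -pmul_cls. Qed.

Lemma clsV (X : Type) (R : seq X -> seq X -> Prop) w :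
  (cls R w)^-1%g = cls R (winv w).
Proof. by rewrite -pinv_cls. Qed.

Section UniversalProperty.
Local Open Scope group_scope.
Variables (X : Type) (G : groupType).
Implicit Types (f : X -> G) (R : seq X -> seq X -> Prop).

Definition eval f (u : seq X) : G := foldr (fun a g => f a * g) 1 u.

Definition satisfies R f := forall u v, R u v -> eval f u = eval f v.

Lemma satisfies_squares R f :
  satisfies (add_squares R) f <-> satisfies R f /\ forall a, f a * f a = 1.
Proof.
split=> [h|[h1 h2] u v [{}u {}v|a]]; last 2 first.
- exact: h1.
- by rewrite /= mulg1 h2.
split=> [u v uv|a]; first exact/h/Old_rel.
by have := h _ _ (Square R a); rewrite /= mulg1.
Qed.

Definition letter_val f (l : X * bool) : G := if l.2 then (f l.1)^-1 else f l.1.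

Definition weval f (w : word X) : G := foldr (fun l g => letter_val f l * g) 1 w.

Lemma weval_cat f v w : weval f (v ++ w) = weval f v * weval f w.
Proof. by elim: v => [|l v IHv] /=; rewrite ?mul1g // IHv mulgA. Qed.

Lemma weval_pos f u : weval f (pos u) = eval f u.
Proof. by elim: u => //= a u ->. Qed.

Lemma weval_eq R f : satisfies R f ->
  forall v w, word_eq R v w -> weval f v = weval f w.
Proof.
move=> h v w; elim=> {v w} // [u v w _ -> _ -> //|u u' v v' _ e1 _ e2|[a []]|u v uv].
- by rewrite !weval_cat e1 e2.
- by rewrite /= /letter_val /= mulg1 mulVg.
- by rewrite /= /letter_val /= mulg1 mulgV.
- by rewrite !weval_pos; apply: h.
Qed.

(** The morphism evaluates the chosen representative; by [weval_eq] the choice does not affect the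
    value. *)
Lemma presented_lift R f : satisfies R f ->
  exists F : {multiplicative presented R -> G}, forall a, F (pgen R a) = f a.
Proof.
move=> h; pose F (g : presented R) := weval f (rep g).
have F_cls w : F (cls R w) = weval f w by apply: weval_eq h _ _ (rep_cls R w).
have FM : {morph F : g k / g * k}.
  (* A product in [presented R] is by definition the class of the concatenated representatives. *)
  by move=> g k; rewrite -weval_cat -F_cls.
pose FH := isMultiplicative.Build _ _ F FM.
pose F' : {multiplicative presented R -> G} := HB.pack F FH.
by exists F' => a; rewrite /= F_cls /= mulg1.
Qed.

Lemma presented_hom_ext R (F F' : {multiplicative presented R -> G}) :
  (forall a, F (pgen R a) = F' (pgen R a)) -> F =1 F'.
Proof.
move=> h g; rewrite -(repK g); elim: (rep g) => [|[a e] w IHw].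
  by rewrite -[cls R [::]]/(1 : presented R) !multiplicative1.
rewrite -cat1s clsM !gmulfM IHw; congr (_ * _).
case: e; last exact: h.
have -> : cls R [:: (a, true)] = (pgen R a)^-1 by rewrite /pgen clsV.
by rewrite !multiplicativeV h.
Qed.

End UniversalProperty.

Lemma eval_pgen (X : Type) (R : seq X -> seq X -> Prop) u :
  eval (pgen R) u = cls R (pos u).
Proof.
elim: u => [|a u IHu] //=.
by rewrite IHu -clsM.
Qed.

Lemma satisfies_pgen (X : Type) (R : seq X -> seq X -> Prop) :
  satisfies R (pgen R).
Proof. by move=> u v uv; rewrite !eval_pgen; apply/clsP/WRel. Qed.

(** * Passing between the two sets of relations *)

Section Relations.
Local Open Scope group_scope.
Variables (r : nat) (G : groupType).

Definition extend (f : gen bool r -> G) (a : gen int r) : G :=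
  match a with
  | Tg i => tfam (f (Tg false)) (f (Tg true)) i
  | Sg j => f (Sg j)
  end.

(** The boolean [b] is coerced to 0 or 1, so [Tg false] and [Tg true] receive the values at t_0 and
    t_1. *)
Definition restrict (f : gen int r -> G) (a : gen bool r) : G :=
  match a with Tg b => f (Tg (Posz b)) | Sg j => f (Sg j) end.

Lemma extend_const_product (f : gen bool r -> G) :
  const_product (fun i => extend f (Tg i)).
Proof. exact: tfam_const_product. Qed.

Lemma extend1 (f : gen bool r -> G) : extend f (Tg 1%R) = f (Tg true).
Proof. exact: tfam1. Qed.

Lemma Q_const_product (f : gen int r -> G) :
  satisfies (@Q_rel r) f -> const_product (fun i => f (Tg i)).
Proof.
move=> h i; have := h _ _ (Q_1 r (i + 1)%R 1%R).
by rewrite /= !mulg1 addrK.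
Qed.

Lemma extend_satisfies (f : gen bool r -> G) :
  satisfies (@B_rel r) f -> satisfies (@Q_rel r) (extend f).
Proof.
move=> h; have tP := extend_const_product f.
move=> u v [{}u {}v uv|i j|j i j3|j i j4].
- case: uv => [i j ij|i j ij].
    exact: h _ _ (B_braid (Braid_comm bool ij)).
  exact: h _ _ (B_braid (Braid_braid bool ij)).
- rewrite /= !mulg1; have := tP (i - 1)%R; have := tP (j - 1)%R.
  by rewrite /= !subrK => -> ->.
- rewrite /= !mulg1 !mulgA.
  apply: (const_product_braided tP (s := f (Sg j))) => /=.
  + by have := h _ _ (B_st false j3); rewrite /= !mulg1 !mulgA.
  (* The member of index 1 has unfolded to t_1 t_0 t_0^-1, which [mulgK] simplifies. *)
  + by rewrite mulgK; have := h _ _ (B_st true j3); rewrite /= !mulg1 !mulgA.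
  + by rewrite mulgK; have := h _ _ (B_stt j3); rewrite /= !mulg1 !mulgA.
- rewrite /= !mulg1.
  apply: (const_product_commute tP (g := f (Sg j))) => /=.
  + by have := h _ _ (B_comm false j4); rewrite /= !mulg1.
  + by rewrite mulgK; have := h _ _ (B_comm true j4); rewrite /= !mulg1.
Qed.

Lemma restrict_satisfies (f : gen int r -> G) :
  satisfies (@Q_rel r) f -> satisfies (@B_rel r) (restrict f).
Proof.
move=> h; have tP := Q_const_product h.
move=> u v [{}u {}v uv|j i j3|j i j4|j j3].
- case: uv => [i j ij|i j ij].
    exact: h _ _ (Q_braid (Braid_comm int ij)).
  exact: h _ _ (Q_braid (Braid_braid int ij)).
- exact: h _ _ (Q_2 i j3).
- exact: h _ _ (Q_3 i j4).
- have := braided_const_product tP (s := f (Sg j)).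
  rewrite /= !mulg1 !mulgA; apply=> i.
  by have := h _ _ (Q_2 i j3); rewrite /= !mulg1 !mulgA.
Qed.

Lemma extend_squares (f : gen bool r -> G) : (forall a, f a * f a = 1) ->
  forall a, extend f a * extend f a = 1.
Proof.
move=> h [i|j]; last exact: h.
apply: (const_product_conj (extend_const_product f) (P := fun g => g * g = 1)).
- by move=> g k gg; rewrite -conjMg gg conj1g.
- exact: h.
- by rewrite /= mulgK.
Qed.

End Relations.

(** [RQ] and [RB] are left general so as to cover the presentations both with and without the
    squares. The two mutually inverse morphisms are induced by [extend] and [restrict]. *)
Lemma presented_iso r RQ RB :
  satisfies RQ (extend (pgen RB)) ->
  satisfies RB (restrict (@pgen (gen int r) RQ)) ->
  const_product (fun i => pgen RQ (Tg i)) ->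
  exists phi : {multiplicative presented RQ -> presented RB},
    bijective phi /\ respects_gens phi.
Proof.
move=> hQ hB tP; have [F FE] := presented_lift hQ; have [K KE] := presented_lift hB.
exists F; split; last by split=> [||j]; rewrite FE // extend1.
exists K => g.
  rewrite -[RHS]/((idfun : {multiplicative _ -> _}) g).
  apply: (presented_hom_ext (F := (K \o F : {multiplicative _ -> _}))) => -[i|j] /=.
    (* Both i |-> K (F t_i) and i |-> t_i have constant product, so agreement at 0 and 1
       suffices. *)
    move: i; apply: const_product_uniq => //.
    + move=> i /=; rewrite !FE -!gmulfM; congr (K _).
      exact: (extend_const_product (pgen RB)).
    + by rewrite /= FE KE.
    + by rewrite /= FE extend1 KE.
  by rewrite FE KE.
rewrite -[RHS]/((idfun : {multiplicative _ -> _}) g).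
apply: (presented_hom_ext (F := (F \o K : {multiplicative _ -> _}))) => -[b|j] /=.
  by rewrite KE /= FE; case: b => //; rewrite extend1.
by rewrite KE /= FE.
Qed.

(** * Generators and their conjugates as reflections *)

Section Reflections.
Local Open Scope ring_scope.
Variables (R : realType) (x : R[i]%C) (r : nat).
Hypotheses (r2 : (2 <= r)%N) (x0 : x != 0).

(** The new hyperplane is the image of the old one under [P], which is injective because [Q] is a
    left inverse. *)
Lemma fixes_hyperplane_conj (P Q M : 'M[R[i]%C]_r) : Q *m P = 1%:M ->
  fixes_hyperplane M -> fixes_hyperplane (P *m M *m Q).
Proof.
move=> QP [H [dimH HP]].
pose f : 'Hom('cV[R[i]%C]_r, 'cV[R[i]%C]_r) := linfun (mulmx P).
exists (f @: H)%VS; split.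
  rewrite limg_dim_eq //; apply/eqP; rewrite -subv0; apply/subvP => v.
  rewrite memv_cap memv_ker lfunE /= memv0 => /andP[_ /eqP Pv0].
  by rewrite -[v]mul1mx -QP -mulmxA Pv0 mulmx0.
move=> _ /memv_imgP[v vH ->]; rewrite lfunE /=.
by rewrite -!mulmxA (mulmxA Q) QP mul1mx HP.
Qed.

Lemma is_reflection_conj (g h : Ginf r) :
  is_reflection x g -> is_reflection x (g ^ h)%g.
Proof.
move=> [g1 gH]; split; first by move/eqP; rewrite conjg_eq1 => /eqP.
rewrite conjgE mulgA !G_mxM //; apply: fixes_hyperplane_conj gH.
by rewrite -G_mxM // mulgV G_mx1.
Qed.

(** By rank-nullity: a nonzero linear form has image of dimension 1. *)
Lemma dim_row_kernel n (u : 'rV[R[i]%C]_n) : u != 0 ->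
  \dim (lker (linfun (mulmx u) : 'Hom('cV[R[i]%C]_n, 'M[R[i]%C]_1))) = n.-1.
Proof.
move=> u0; set f := linfun _.
have := limg_ker_dim f fullv; rewrite capfv dimvf /dim /= muln1.
suff -> : \dim (limg f) = 1%N by lia.
apply/eqP; rewrite eqn_leq; apply/andP; split.
  by apply: leq_trans (dimvS (subvf _)) _; rewrite dimvf /dim /= muln1.
rewrite lt0n dimv_eq0; apply: contra u0 => /eqP f0.
apply/eqP/rowP => j; have /eqP : f (delta_mx j 0) == 0.
  by rewrite -memv0 -f0 memv_img ?memvf.
by rewrite lfunE /= -colE => /matrixP/(_ 0 0); rewrite !mxE.
Qed.

Lemma gcoef_mul (a : gen bool r) : gcoef x a (gpos a) * gcoef x a (gpos a).+1 = 1.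
Proof. by case: a => [b|j] /=; rewrite ?mulr1 // mulVf // expf_neq0. Qed.

Lemma gcoef_id (a : gen bool r) k :
  k != gpos a -> k != (gpos a).+1 -> gcoef x a k = 1.
Proof. by case: a k => [b|j] [|[|k]]. Qed.

(** Each generator swaps coordinates p and p+1 up to mutually inverse coefficients and leaves the
    others alone; its hyperplane is v_p = c_p v_(p+1). *)
Lemma is_reflection_gen (a : gen bool r) :
  is_reflection x (pgen (add_squares (@B_rel r)) a).
Proof.
have ha := gpos_lt a r2.
set p := gpos a in ha; set c := gcoef x a.
pose i0 := Ordinal (ltnW ha); pose i1 := Ordinal ha.
split.
  move=> /(congr1 (@G_mx R x r)); rewrite G_mx_gen // G_mx1 // gen_mxE.
  (* The diagonal entry at p is 0 for the generator and 1 for the identity. *)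
  move=> /matrixP/(_ i0 i0); rewrite !mxE /= eqxx /swp /= -/p eqxx.
  rewrite gtn_eqF // mulr0n => /esym/eqP.
  by rewrite oner_eq0.
pose u : 'rV[R[i]%C]_r := delta_mx 0 i0 - c p *: delta_mx 0 i1.
exists (lker (linfun (mulmx u))); split.
  apply: dim_row_kernel; apply/eqP => /rowP/(_ i0); rewrite !mxE !eqxx /=.
  by rewrite -val_eqE /= ltn_eqF // mulr0 subr0 => /eqP; rewrite oner_eq0.
move=> v; rewrite memv_ker lfunE /= mulmxBl -scalemxAl -!rowE.
move=> /eqP/matrixP/(_ 0 0); rewrite !mxE => /eqP; rewrite subr_eq0 => /eqP hv.
rewrite G_mx_gen // gen_mxE; apply/matrixP => k l; rewrite (ord1 l) {l} mxE.
pose k' := Ordinal (swp_lt ha (ltn_ord k)).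
rewrite (bigD1 k') //= big1 ?addr0 => [|l lk]; last first.
  move: lk; rewrite mxE -val_eqE /= eq_sym => /negPf ->.
  by rewrite mulr0n mul0r.
rewrite mxE eqxx mulr1n /k' {k'}.
(* Row p is the equation of the hyperplane; row p+1 is equivalent to it because c_p c_(p+1) = 1;
   every other row is trivial. *)
case: (eqVneq (k : nat) p) => [kp|k0].
  have -> : k = i0 by apply/val_inj.
  rewrite hv; congr (_ * v _ _).
  by apply/val_inj; rewrite /= /swp eqxx.
case: (eqVneq (k : nat) p.+1) => [kp|k1].
  have -> : k = i1 by apply/val_inj.
  have -> : Ordinal (swp_lt ha (ltn_ord i1)) = i0.
    by apply/val_inj; rewrite /= /swp eqxx gtn_eqF.
  by rewrite hv mulrA [c _ * _]mulrC gcoef_mul mul1r.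
rewrite gcoef_id // mul1r; congr (v _ _).
by apply/val_inj; rewrite /= /swp (negPf k0) (negPf k1).
Qed.

End Reflections.

Theorem theorem3p1 (r : nat) (hr : (2 <= r)%N)
    (R : realType) (x : R[i]%C) (hx : transcendental x) :
  (exists phi : {multiplicative presented (@Q_rel r) -> Binf r},
      bijective phi /\ respects_gens phi) /\
  (exists psi : {multiplicative presented (add_squares (@Q_rel r)) -> Ginf r},
      [/\ bijective psi,
          respects_gens psi
        & forall a : gen int r,
            is_reflection x (psi (pgen (add_squares (@Q_rel r)) a))]).
Proof.
split.
  apply: presented_iso.
  - exact/extend_satisfies/satisfies_pgen.
  - exact/restrict_satisfies/satisfies_pgen.
  - exact/Q_const_product/satisfies_pgen.
(* With squares adjoined, the canonical generators still satisfy the old relations, so the same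
   extension and restriction apply. *)
have [hQ hQ2] := (satisfies_squares _ _).1
  (@satisfies_pgen _ (add_squares (@Q_rel r))).
have [hB hB2] := (satisfies_squares _ _).1
  (@satisfies_pgen _ (add_squares (@B_rel r))).
have tP := Q_const_product hQ.
have [||//|psi [psi_bij psi_gens]] := @presented_iso r
    (add_squares (@Q_rel r)) (add_squares (@B_rel r)).
- apply/satisfies_squares; split; first exact: extend_satisfies.
  exact: extend_squares.
- apply/satisfies_squares; split; first exact: restrict_satisfies.
  by case=> [b|j]; apply: hQ2.
exists psi; split=> //; case: psi_gens => e0 e1 eS.
have x0 := transcendental_neq0 hx.
have refl := is_reflection_gen hr x0.
case=> [i|j]; last by rewrite eS.
(* The images of the t_i again have constant product, so each is conjugate to the image of t_0 or
   t_1. *)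
have psiP : const_product (fun i => psi (pgen _ (Tg i))).
  by move=> k; rewrite -!gmulfM; congr (psi _); apply: tP.
apply: (const_product_conj psiP (P := fun g : Ginf r => is_reflection x g)).
- by move=> g h; apply: is_reflection_conj.
- by rewrite e0.
- by rewrite e1.
Qed.
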